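(* For $k=1,2$ let $t_k\in\mathbb{C}$ be an $8$th root of unity and let $a_k,c_k,d_k\in\mathbb{C}$ satisfy $c_k=a_k^2-a_kd_k+d_k^2$, $c_k\neq 0$ and $a_k\neq d_k$; assume also $a_1a_2d_1d_2\neq 0$. Let $\rho_k=\rho(-1,t_k,a_k,c_k,d_k)$ be the corresponding $2$-dimensional representation of the necklace braid group $\mathcal{NB}_4$, and let $\rho=\rho_1\otimes\rho_2:\mathcal{NB}_4\to GL(4,\mathbb{C})$. Then $\rho$ is irreducible if and only if $a_1a_2\neq d_1d_2$ and $a_1d_2\neq a_2d_1$.
   Context: The necklace braid group $\mathcal{NB}_n$ is the group with generators $\sigma_1,\dots,\sigma_n,\tau$ and relations (indices taken modulo $n$, so $\sigma_{n+1}=\sigma_1$): $\sigma_i\sigma_{i+1}\sigma_i=\sigma_{i+1}\sigma_i\sigma_{i+1}$; $\sigma_i\sigma_j=\sigma_j\sigma_i$ whenever $i-j\not\equiv\pm1 \pmod n$; $\tau\sigma_i\tau^{-1}=\sigma_{i+1}$; $\tau^{2n}=1$. For the parameters considered, $\rho(T,t,a,c,d)$ denotes the representation of $\mathcal{NB}_n$ on $\mathbb{C}^2$ with $\tau\mapsto\begin{pmatrix}Tt&0\\0&t\end{pmatrix}$ and $\sigma_i\mapsto\begin{pmatrix}a&T^{i-1}\\ cT^{1-i}&d\end{pmatrix}$ for $1\le i\le n$ (here $n=4$). The tensor product is $(\rho_1\otimes\rho_2)(g)=\rho_1(g)\otimes\rho_2(g)$ (Kronecker product of matrices). *)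

(* Defs.v *)
From HB Require Import structures.
From mathcomp Require Import all_boot all_order all_algebra.
From mathcomp Require Import boolp mxtens ring.

Set Implicit Arguments.
Unset Strict Implicit.
Unset Printing Implicit Defensive.

Import GRing.Theory.
Local Open Scope quotient_scope.
Local Open Scope ring_scope.

(* A letter (x, true) of a word stands for x, a letter (x, false) for x^-1.   *)
Definition word (X : Type) := seq (X * bool).

Definition gen (X : Type) (x : X) : X * bool := (x, true).
Definition ginv (X : Type) (x : X) : X * bool := (x, false).

Section PresentedGroup.
Variables (X : choiceType) (R : word X -> word X -> Prop).

(* The smallest congruence on words which contains R and for which the two    *)
(* letters of each generator are mutually inverse.                            *)
Inductive pres_eq : word X -> word X -> Prop :=
| pres_refl u : pres_eq u u
| pres_sym u v : pres_eq u v -> pres_eq v u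
| pres_trans u v w : pres_eq u v -> pres_eq v w -> pres_eq u w
| pres_cat u u' v v' :
    pres_eq u u' -> pres_eq v v' -> pres_eq (u ++ v) (u' ++ v')
| pres_cancel x b : pres_eq [:: (x, b); (x, ~~ b)] [::]
| pres_relator u v : R u v -> pres_eq u v.

Definition pres_eqb : rel (word X) := fun u v => `[< pres_eq u v >].

Lemma pres_eqb_refl : reflexive pres_eqb.
Proof. by move=> u; apply/asboolP; apply: pres_refl. Qed.

Lemma pres_eqb_sym : symmetric pres_eqb.
Proof. by move=> u v; apply/asboolP/asboolP; apply: pres_sym. Qed.

Lemma pres_eqb_trans : transitive pres_eqb.
Proof.
by move=> v u w /asboolP uv /asboolP vw; apply/asboolP; apply: pres_trans uv vw.
Qed.

Canonical pres_equiv :=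
  EquivRel pres_eqb pres_eqb_refl pres_eqb_sym pres_eqb_trans.

Definition presented := {eq_quot pres_equiv}.

HB.instance Definition _ := Choice.on presented.
HB.instance Definition _ := Quotient.on presented.

Definition pres_class (u : word X) : presented := \pi_presented%qT u.

Lemma pres_classP u v : pres_class u = pres_class v <-> pres_eq u v.
Proof.
split=> [/eqP|uv]; first by rewrite eqmodE /= => /asboolP.
by apply/eqP; rewrite eqmodE /=; apply/asboolP.
Qed.

Lemma pres_reprK (g : presented) : pres_class (repr g) = g.
Proof. exact: reprK. Qed.

Lemma pres_repr_class u : pres_eq (repr (pres_class u)) u.
Proof. by apply/pres_classP; rewrite pres_reprK. Qed.

Definition word_inv (u : word X) : word X := rev [seq (l.1, ~~ l.2) | l <- u].

Lemma word_inv_cat u v : word_inv (u ++ v) = word_inv v ++ word_inv u.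
Proof. by rewrite /word_inv map_cat rev_cat. Qed.

Lemma word_invK : involutive word_inv.
Proof.
move=> u; rewrite /word_inv map_rev revK -map_comp -[RHS]map_id.
by apply: eq_map => -[x b] /=; rewrite negbK.
Qed.

Lemma word_mulV u : pres_eq (u ++ word_inv u) [::].
Proof.
elim: u => [|[x b] u IHu]; first exact: pres_refl.
have -> : ((x, b) :: u) ++ word_inv ((x, b) :: u) =
    [:: (x, b)] ++ ((u ++ word_inv u) ++ [:: (x, ~~ b)]).
  by rewrite -[in LHS]cat1s word_inv_cat /= catA.
have H := pres_cat IHu (pres_refl [:: (x, ~~ b)]).
exact: pres_trans (pres_cat (pres_refl [:: (x, b)]) H) (pres_cancel x b).
Qed.

Lemma word_mulVw u : pres_eq (word_inv u ++ u) [::].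
Proof. by have := word_mulV (word_inv u); rewrite word_invK. Qed.

Lemma pres_eq_inv u v : pres_eq u v -> pres_eq (word_inv u) (word_inv v).
Proof.
move=> uv; apply: (@pres_trans _ (word_inv u ++ (v ++ word_inv v))).
  rewrite -[X in pres_eq X _]cats0.
  by apply: pres_cat; [exact: pres_refl | exact/pres_sym/word_mulV].
rewrite catA -[X in pres_eq _ X]cat0s.
apply: pres_cat; last exact: pres_refl.
apply: pres_trans (word_mulVw u).
by apply: pres_cat; [exact: pres_refl | exact: pres_sym].
Qed.

Definition pres_one : presented := pres_class [::].
Definition pres_mul (g h : presented) : presented :=
  pres_class (repr g ++ repr h).
Definition pres_inv (g : presented) : presented :=
  pres_class (word_inv (repr g)).

Lemma pres_mulE u v :
  pres_mul (pres_class u) (pres_class v) = pres_class (u ++ v).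
Proof. by apply/pres_classP/pres_cat; apply: pres_repr_class. Qed.

Lemma pres_invE u : pres_inv (pres_class u) = pres_class (word_inv u).
Proof. exact/pres_classP/pres_eq_inv/pres_repr_class. Qed.

Lemma pres_mulA : associative pres_mul.
Proof.
move=> g h k; rewrite -[g]pres_reprK -[h]pres_reprK -[k]pres_reprK.
by rewrite !pres_mulE catA.
Qed.

Lemma pres_mul1 : left_id pres_one pres_mul.
Proof. by move=> g; rewrite -[g]pres_reprK pres_mulE. Qed.

Lemma pres_mul1r : right_id pres_one pres_mul.
Proof. by move=> g; rewrite -[g]pres_reprK pres_mulE cats0. Qed.

Lemma pres_mulV : left_inverse pres_one pres_inv pres_mul.
Proof.
move=> g; rewrite -[g]pres_reprK pres_invE pres_mulE.
exact/pres_classP/word_mulVw.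
Qed.

Lemma pres_mulVr : right_inverse pres_one pres_inv pres_mul.
Proof.
move=> g; rewrite -[g]pres_reprK pres_invE pres_mulE.
exact/pres_classP/word_mulV.
Qed.

HB.instance Definition _ := isGroup.Build presented
  pres_mulA pres_mul1 pres_mul1r pres_mulV pres_mulVr.

End PresentedGroup.

Section NecklaceBraidGroup.
Variable n : nat.

(* Indices are 0-based: for i : 'I_n, Sigma i is the generator sigma_(i+1).   *)
Inductive nb_gen := Sigma of 'I_n | Tau.

Definition nb_gen_option (x : nb_gen) := if x is Sigma i then Some i else None.
Definition option_nb_gen o := if o is Some i then Sigma i else Tau.
Lemma nb_gen_optionK : cancel nb_gen_option option_nb_gen.
Proof. by case. Qed.
HB.instance Definition _ := Choice.copy nb_gen (can_type nb_gen_optionK).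

(* ordS i is i + 1 modulo n.                                                  *)
Inductive nb_rel : word nb_gen -> word nb_gen -> Prop :=
| nb_braid i :
    nb_rel [:: gen (Sigma i); gen (Sigma (ordS i)); gen (Sigma i)]
           [:: gen (Sigma (ordS i)); gen (Sigma i); gen (Sigma (ordS i))]
| nb_commute i j : i != ordS j -> j != ordS i ->
    nb_rel [:: gen (Sigma i); gen (Sigma j)] [:: gen (Sigma j); gen (Sigma i)]
| nb_rotate i :
    nb_rel [:: gen Tau; gen (Sigma i); ginv Tau] [:: gen (Sigma (ordS i))]
| nb_tau_order : nb_rel (nseq (2 * n) (gen Tau)) [::].

Definition NB := presented nb_rel.
HB.instance Definition _ := Group.on NB.

End NecklaceBraidGroup.
Arguments Tau {n}.

Section Representations.
Variable F : fieldType.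

(* A homomorphism G -> GL_m(F): its values are invertible by rep_mx_unit.      *)
(* Matrices act on column vectors by left multiplication.                     *)
Record representation (G : groupType) (m : nat) := Representation {
  rep_mx :> G -> 'M[F]_m;
  rep_mx1 : rep_mx 1%g = 1%:M;
  rep_mxM : forall g h, rep_mx (g * h)%g = rep_mx g *m rep_mx h }.

Lemma rep_mx_unit (G : groupType) m (rho : representation G m) g :
  rho g \in unitmx.
Proof.
by apply: (proj1 (mulmx1_unit (B := rho g^-1%g) _)); rewrite -rep_mxM mulgV rep_mx1.
Qed.

Definition irreducible_rep (G : groupType) m (rho : representation G m) :=
  (0 < m)%N /\
  forall W : {vspace 'cV[F]_m},
    (forall g v, v \in W -> rho g *m v \in W) -> W = 0%VS \/ W = fullv.

Lemma tens1mx1 m1 m2 : (1%:M : 'M[F]_m1) *t (1%:M : 'M[F]_m2) = 1%:M.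
Proof.
apply/matrixP=> i j.
case: (mxtens_indexP i) => i1 i2; case: (mxtens_indexP j) => j1 j2.
rewrite tensmxE !mxE (can_eq (@mxtens_indexK _ _)) xpair_eqE.
by case: (i1 == j1); case: (i2 == j2); rewrite ?(mulr1, mulr0, mul0r).
Qed.

Section Tensor.
Variables (G : groupType) (m1 m2 : nat).
Variables (rho1 : representation G m1) (rho2 : representation G m2).

Let tensor_mx g := rho1 g *t rho2 g.

Lemma tensor_mx1 : tensor_mx 1%g = 1%:M.
Proof. by rewrite /tensor_mx !rep_mx1 tens1mx1. Qed.

Lemma tensor_mxM g h : tensor_mx (g * h)%g = tensor_mx g *m tensor_mx h.
Proof. by rewrite /tensor_mx !rep_mxM tensmx_mul. Qed.

Definition tensor_rep : representation G (m1 * m2) :=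
  Representation tensor_mx1 tensor_mxM.

End Tensor.

Section PresentedRep.
Variables (X : choiceType) (R : word X -> word X -> Prop) (m : nat).
Variable f : X -> 'M[F]_m.

Definition letter_mx (l : X * bool) := if l.2 then f l.1 else invmx (f l.1).

Definition word_mx (u : word X) : 'M[F]_m :=
  foldr (fun l A => letter_mx l *m A) 1%:M u.

Definition satisfies_relations :=
  (forall x, f x \in unitmx) /\ (forall u v, R u v -> word_mx u = word_mx v).

Lemma word_mx_cat u v : word_mx (u ++ v) = word_mx u *m word_mx v.
Proof. by elim: u => [|l u IHu] /=; rewrite ?mul1mx // IHu mulmxA. Qed.

Hypothesis fR : satisfies_relations.

Lemma word_mx_eq u v : pres_eq R u v -> word_mx u = word_mx v.
Proof.
case: fR => fU fE; elim=> {u v} //.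
- by move=> u v w _ -> _ ->.
- by move=> u u' v v' _ eu _ ev; rewrite !word_mx_cat eu ev.
- by move=> x [] /=; rewrite mulmx1 /letter_mx /= ?mulmxV ?mulVmx.
Qed.

Definition pres_mx (g : presented R) := word_mx (repr g).

Lemma pres_mx_class u : pres_mx (pres_class R u) = word_mx u.
Proof. exact/word_mx_eq/pres_repr_class. Qed.

Lemma pres_mx1 : pres_mx 1%g = 1%:M.
Proof. exact: pres_mx_class. Qed.

Lemma pres_mxM g h : pres_mx (g * h)%g = pres_mx g *m pres_mx h.
Proof. by rewrite [LHS]pres_mx_class word_mx_cat. Qed.

(* The representation of <X | R> determined by the images f of the generators.*)
Definition pres_rep : representation (presented R) m :=
  Representation pres_mx1 pres_mxM.

Lemma pres_rep_gen x : pres_rep (pres_class R [:: gen x]) = f x.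
Proof. by rewrite /= pres_mx_class /= mulmx1. Qed.

End PresentedRep.

Definition mx22 (x y z w : F) : 'M[F]_2 :=
  \matrix_(i, j) if i == 0 then (if j == 0 then x else y)
                 else (if j == 0 then z else w).

Section Rho.
Variables (n : nat) (T t a c d : F).

(* The exponents are i and not i - 1 because Sigma i is sigma_(i+1).          *)
Definition rho_gen (x : nb_gen n) : 'M[F]_2 :=
  match x with
  | Sigma i => mx22 a (T ^+ i) (c * T ^- i) d
  | Tau => mx22 (T * t) 0 0 t
  end.

Definition rho (h : satisfies_relations (@nb_rel n) rho_gen) :
  representation (NB n) 2 := pres_rep h.

End Rho.

Lemma mx22M x y z w x' y' z' w' :
  mx22 x y z w *m mx22 x' y' z' w' =
  mx22 (x * x' + y * z') (x * y' + y * w') (z * x' + w * z') (z * y' + w * w').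
Proof.
by apply/matrixP=> i j; rewrite !mxE !big_ord_recl big_ord0 !mxE /= addr0;
   case: eqP; case: eqP.
Qed.

Lemma mx22_1 : mx22 1 0 0 1 = 1%:M.
Proof.
by apply/matrixP=> i j; rewrite !mxE; case: i j => [[|[]]] // ? [[|[]]].
Qed.

Lemma mx22_unit x y z w : x * w - y * z != 0 -> mx22 x y z w \in unitmx.
Proof.
move=> D0; set D := x * w - y * z in D0.
apply: (proj1 (mulmx1_unit (B := mx22 (w / D) (- y / D) (- z / D) (x / D)) _)).
by rewrite mx22M -mx22_1; congr mx22; rewrite /D; field.
Qed.

Lemma nb4_satisfies (t a c d : F) :
    8.-unity_root t -> c = a ^+ 2 - a * d + d ^+ 2 -> a != d ->
  satisfies_relations (@nb_rel 4) (rho_gen (-1) t a c d).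
Proof.
move=> /unity_rootP t8 cE ad.
have t0 : t != 0.
  by apply: contra_eq_neq t8 => ->; rewrite expr0n eq_sym oner_eq0.
pose M e := mx22 a e (c * e) d.
have sE (i : 'I_4) : rho_gen (-1) t a c d (Sigma i) = M ((-1) ^+ i).
  by rewrite /= /M -exprVn invrN1.
have oddE (i : 'I_4) : (-1) ^+ (ordS i) = - (-1) ^+ i :> F.
  by case: i => [[|[|[|[]]]]] //= _; rewrite /= ?expr0 ?expr1; ring.
have e2 (i : 'I_4) : (-1) ^+ i * (-1) ^+ i = 1 :> F.
  by rewrite -exprD addnn -mul2n exprM sqrrN expr1n expr1n.
have tU : rho_gen (-1) t a c d (@Tau 4) \in unitmx.
  by rewrite /=; apply: mx22_unit; rewrite mul0r subr0 mulN1r mulNr oppr_eq0 mulf_neq0.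
split.
  case=> [i|]; last exact: tU.
    rewrite sE; apply: mx22_unit.
    have -> : a * d - (-1) ^+ i * (c * (-1) ^+ i) = - (a - d) ^+ 2.
      by rewrite mulrCA e2 cE; ring.
    by rewrite oppr_eq0 expf_eq0 subr_eq0.
have epm (i : 'I_4) : (-1) ^+ i = 1 :> F \/ (-1) ^+ i = -1 :> F.
  by rewrite -!(signr_odd _ i); case: (odd i); [right | left].
move=> u v; case=> {u v}.
- move=> i; rewrite /word_mx /= /letter_mx /gen !mulmx1 !sE oddE.
  by case: (epm i) => ->; rewrite /M !mx22M; congr mx22; rewrite cE; ring.
- move=> i j ij ji; rewrite /word_mx /= /letter_mx /gen !mulmx1 !sE.
  have -> : (-1) ^+ i = (-1) ^+ j :> F.
    rewrite -[LHS]signr_odd -[RHS]signr_odd; congr (_ ^+ _); congr nat_of_bool.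
    move: ij ji; rewrite -!val_eqE.
    by case: i j => [[|[|[|[]]]]] //= ? [[|[|[|[]]]]].
  by [].
- move=> i; rewrite /word_mx /= /letter_mx /gen /ginv !mulmx1 mulmxA.
  apply: (canLR (mulmxK tU)); rewrite !sE oddE /M /= !mx22M.
  by case: (epm i) => ->; congr mx22; ring.
- rewrite /word_mx /letter_mx /= mulmx1 !mx22M -mx22_1.
  by congr mx22; [rewrite -[RHS]t8 | | | rewrite -[RHS]t8]; ring.
Qed.

End Representations.

Arguments rho {F} n T t a c d h.

(* Main.v *)
(* The eigenspaces of tau split C^4 into E = <e00, e11> and O = <e01, e10>, so
   stable subspaces are the graded subspaces stable under the even part P and
   the odd part Q of sigma_i (sigma_i is P + Q or P - Q). Up to sign, both
   Q : E -> O and Q : O -> E have determinant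
   (d1 a2 - a1 d2) (a1 a2 - d1 d2). When a factor vanishes, the kernel of Q on E
   or on O is a P-eigenline. Otherwise Q is invertible, so a proper nonzero
   stable subspace would meet E in a common eigenline of P and Q^2, and there is
   none. *)

Require Import Defs.
From mathcomp Require Import all_boot all_order all_algebra.
From mathcomp Require Import reals complex.
From mathcomp Require Import mxtens ring.

Set Implicit Arguments.
Unset Strict Implicit.

Import GRing.Theory.
Local Open Scope ring_scope.
Local Open Scope complex_scope.

(** * Stable lines of presented groups, and membership in subspaces *)

Section GeneratorInduction.
Variables (X : choiceType) (R : word X -> word X -> Prop).

Lemma presented_ind (P : presented R -> Prop) :
    P 1%g -> (forall g h, P g -> P h -> P (g * h)%g) ->
    (forall g, P g -> P g^-1%g) ->
    (forall x, P (pres_class R [:: gen x])) ->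
  forall g, P g.
Proof.
move=> P1 PM PV Pgen g; rewrite -[g]pres_reprK.
elim: (repr g) => [|[x b] u IHu]; first exact: P1.
rewrite -cat1s -pres_mulE; apply: PM (IHu).
case: b; first exact: Pgen.
suff -> : pres_class R [:: (x, false)] = (pres_class R [:: gen x])^-1%g.
  exact: PV.
by rewrite [RHS]pres_invE.
Qed.

End GeneratorInduction.

Lemma eigenvector_inv (F : fieldType) (G : groupType) m
    (rho : representation F G m) (v : 'cV[F]_m) g :
  (exists l, rho g *m v = l *: v) -> exists l, rho g^-1%g *m v = l *: v.
Proof.
move=> [l gv]; have vE : v = l *: (rho g^-1%g *m v).
  by rewrite scalemxAr -gv mulmxA -rep_mxM mulVg rep_mx1 mul1mx.
(* Here [vE] forces [v] to vanish when [l] does, so any scalar serves. *)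
have [l0|l0] := eqVneq l 0.
  by exists 0; rewrite vE l0 !scale0r mulmx0.
by exists l^-1; rewrite [in RHS]vE scalerA mulVf // scale1r.
Qed.

(** Being an eigenvector passes from generators to products and inverses, so the line through [v] is
    stable under the whole group. It is nonzero, and proper because [m] exceeds 1. *)
Lemma common_eigenvector_reducible (F : fieldType) (X : choiceType)
    (R : word X -> word X -> Prop) m (rho : representation F (presented R) m)
    (v : 'cV[F]_m) :
    (1 < m)%N -> v != 0 ->
    (forall x, exists l, rho (pres_class R [:: gen x]) *m v = l *: v) ->
  ~ irreducible_rep rho.
Proof.
move=> m_gt1 v0 v_gen [_ irr].
have v_eig g : exists l, rho g *m v = l *: v.
  elim/presented_ind: g => [|g h [l gv] [k hv]|g|//].
  - by exists 1; rewrite rep_mx1 mul1mx scale1r.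
  - by exists (k * l); rewrite rep_mxM -mulmxA hv -scalemxAr gv scalerA.
  - exact: eigenvector_inv.
have [g w /vlineP[k ->]|W0|WT] := irr <[v]>%VS.
- have [l gv] := v_eig g.
  by rewrite -scalemxAr gv !memvZ // memv_line.
- by move: v0; rewrite -memv0 -W0 memv_line.
- have := dim_vline v; rewrite WT dimvf v0 /dim /= muln1 => m1.
  by rewrite m1 in m_gt1.
Qed.

(** Cramer's rule: the determinant times [u], and times [v], is a combination of the two given
    vectors. *)
Lemma memv_det (F : fieldType) (V : vectType F) (W : {vspace V}) (u v : V)
    (x y x' y' : F) :
    x *: u + y *: v \in W -> x' *: u + y' *: v \in W -> x * y' - y * x' != 0 ->
  u \in W /\ v \in W.
Proof.
move=> xyW xyW' D0; set D := _ - _ in D0.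
have mem z : D *: z \in W -> z \in W.
  by move=> /(memvZ D^-1); rewrite scalerA mulVf // scale1r.
split; apply: mem.
- have -> : D *: u = y' *: (x *: u + y *: v) - y *: (x' *: u + y' *: v).
    rewrite !scalerDr !scalerA opprD addrACA -!scalerBl.
    by rewrite [y' * y]mulrC subrr scale0r addr0 [y' * x]mulrC.
  by rewrite memvB ?memvZ.
- have -> : D *: v = x *: (x' *: u + y' *: v) - x' *: (x *: u + y *: v).
    rewrite !scalerDr !scalerA opprD addrACA -!scalerBl.
    by rewrite [x' * x]mulrC subrr scale0r add0r [x' * y]mulrC.
  by rewrite memvB ?memvZ.
Qed.

(** * Coordinates on the tensor product of two planes *)

Section Coordinates.
Variable F : fieldType.

(** The basis is e00, e01, e10, e11 in the Kronecker order, so [x], [w] are the coordinates on E and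
    [y], [z] those on O. *)
Definition vec4 (x y z w : F) : 'cV[F]_(2 * 2) := \col_i nth 0 [:: x; y; z; w] i.

Lemma vec4_eta (v : 'cV[F]_(2 * 2)) : exists x y z w, v = vec4 x y z w.
Proof.
pose o i (h : (i < 4)%N) := v (Ordinal h) 0.
exists (o 0%N isT), (o 1%N isT), (o 2%N isT), (o 3%N isT).
apply/matrixP => i j; rewrite mxE (ord1 j).
by case: i => [[|[|[|[|//]]]] h]; congr (v _ _); apply: val_inj.
Qed.

Lemma vec4D x y z w x' y' z' w' :
  vec4 x y z w + vec4 x' y' z' w' = vec4 (x + x') (y + y') (z + z') (w + w').
Proof.
by apply/matrixP => i j; rewrite !mxE; case: i => [[|[|[|[|//]]]] h].
Qed.

Lemma vec4Z k x y z w : k *: vec4 x y z w = vec4 (k * x) (k * y) (k * z) (k * w).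
Proof.
by apply/matrixP => i j; rewrite !mxE; case: i => [[|[|[|[|//]]]] h].
Qed.

Lemma vec4_eq0 x y z w :
  (vec4 x y z w == 0) = [&& x == 0, y == 0, z == 0 & w == 0].
Proof.
apply/eqP/and4P => [/matrixP v0|[/eqP-> /eqP-> /eqP-> /eqP->]].
  pose e i (h : (i < 4)%N) := v0 (Ordinal h) 0.
  have := (e 0%N isT, e 1%N isT, e 2%N isT, e 3%N isT).
  by rewrite !mxE /= => -[[[-> ->] ->] ->]; split.
by apply/matrixP => i j; rewrite !mxE; case: i => [[|[|[|[|//]]]] h].
Qed.

Lemma tens_mx22_vec4 p q r s p' q' r' s' x y z w :
  (mx22 p q r s *t mx22 p' q' r' s') *m vec4 x y z w =
  vec4 (p * p' * x + p * q' * y + q * p' * z + q * q' * w)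
       (p * r' * x + p * s' * y + q * r' * z + q * s' * w)
       (r * p' * x + r * q' * y + s * p' * z + s * q' * w)
       (r * r' * x + r * s' * y + s * r' * z + s * s' * w).
Proof.
apply/matrixP => i j; rewrite !mxE !big_ord_recl big_ord0 !mxE addr0 !addrA.
by case: i => [[|[|[|[|//]]]] h].
Qed.

End Coordinates.

(** * The generators on the tensor product, and the two reducible cases *)

Section TensorNB4.
Variables (F : fieldType) (t1 a1 c1 d1 t2 a2 c2 d2 : F).
Hypotheses (h1 : satisfies_relations (@nb_rel 4) (rho_gen (-1) t1 a1 c1 d1))
           (h2 : satisfies_relations (@nb_rel 4) (rho_gen (-1) t2 a2 c2 d2)).
Hypotheses (c1E : c1 = a1 ^+ 2 - a1 * d1 + d1 ^+ 2)
           (c2E : c2 = a2 ^+ 2 - a2 * d2 + d2 ^+ 2).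

Let rep := tensor_rep (rho 4 (-1) t1 a1 c1 d1 h1) (rho 4 (-1) t2 a2 c2 d2 h2).
Let cl x : NB 4 := pres_class (@nb_rel 4) [:: gen x].

Lemma tensor_gen x :
  rep (cl x) = rho_gen (-1) t1 a1 c1 d1 x *t rho_gen (-1) t2 a2 c2 d2 x.
Proof. by congr (_ *t _); exact: pres_rep_gen. Qed.

(** As [e] is its own inverse, the entries sort into those free of [e], which form P, and those
    linear in [e], which form Q. *)
Lemma tensor_sigma (i : 'I_4) x y z w (e := (-1) ^+ i : F) :
  rep (cl (Sigma i)) *m vec4 x y z w =
  vec4 (a1 * a2 * x + w + e * (a1 * y + a2 * z))
         (a1 * d2 * y + c2 * z + e * (a1 * c2 * x + d2 * w))
         (c1 * y + d1 * a2 * z + e * (c1 * a2 * x + d1 * w))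
         (c1 * c2 * x + d1 * d2 * w + e * (c1 * d2 * y + d1 * c2 * z)).
Proof.
have e2 : e * e = 1 by rewrite -expr2 sqrr_sign.
have eV : (-1) ^- i = e by rewrite -exprVn invrN1.
rewrite tensor_gen /= eV -/e tens_mx22_vec4.
by congr vec4; ring: e2.
Qed.

Lemma tensor_tau x y z w :
  rep (cl Tau) *m vec4 x y z w = (t1 * t2) *: vec4 x (- y) (- z) w.
Proof.
rewrite tensor_gen /= tens_mx22_vec4 vec4Z.
by congr vec4; ring.
Qed.

(** In the chosen bases the left side is the determinant of Q from E to O, and also that of Q from O
    to E. *)
Lemma odd_part_det : a1 * c2 * d1 - d2 * c1 * a2 =
  (d1 * a2 - a1 * d2) * (a1 * a2 - d1 * d2).
Proof. by rewrite c1E c2E; ring. Qed.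

(** The witness spans the kernel of Q on E: one coordinate of its image cancels identically, the
    other by [Q1]. *)
Lemma tensor_reducible_even :
  d1 != 0 -> a2 != 0 -> a1 * a2 = d1 * d2 -> ~ irreducible_rep rep.
Proof.
move=> d10 a20 ad; have := odd_part_det; rewrite ad subrr mulr0 => /subr0_eq Q1.
have cE : c2 * d1 ^+ 2 = c1 * a2 ^+ 2 by rewrite c1E c2E; ring: ad.
apply: (@common_eigenvector_reducible _ _ _ _ rep
         (vec4 d1 0 0 (- (c1 * a2)))) => //.
  by rewrite vec4_eq0 negb_and d10.
case=> [i|].
  (* The eigenvalue is read off the first coordinate of the image; [cE] makes the last coordinate
     agree. *)
  exists (a1 * a2 - c1 * a2 / d1); rewrite tensor_sigma vec4Z.
  congr vec4; [by field|by ring: Q1|by ring|].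
  by apply: (mulfI d10); field: cE ad.
by exists (t1 * t2); rewrite tensor_tau oppr0.
Qed.

(** The same argument on O, where the witness spans the kernel of Q and its second coordinate gives
    the eigenvalue. *)
Lemma tensor_reducible_odd :
  a1 != 0 -> a2 != 0 -> a1 * d2 = a2 * d1 -> ~ irreducible_rep rep.
Proof.
move=> a10 a20 ad; have := odd_part_det.
rewrite ad [d1 * a2]mulrC subrr mul0r => /subr0_eq Q1.
have cE : c1 * a2 ^+ 2 = c2 * a1 ^+ 2 by rewrite c1E c2E; ring: ad.
apply: (@common_eigenvector_reducible _ _ _ _ rep
         (vec4 0 a2 (- a1) 0)) => //.
  by rewrite vec4_eq0 !negb_and a20 orbT.
case=> [i|].
  exists (a1 * d2 - c2 * a1 / a2); rewrite tensor_sigma vec4Z.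
  congr vec4; [by ring|by field| |by ring: Q1].
  by apply: (mulfI a20); field: cE ad.
by exists (- (t1 * t2)); rewrite tensor_tau !vec4Z; congr vec4; ring.
Qed.

(** * Stable subspaces when Q is invertible *)

Section Irreducible.
Hypotheses (c10 : c1 != 0) (c20 : c2 != 0) (ad1 : a1 != d1) (ad2 : a2 != d2).
Hypotheses (t10 : t1 != 0) (t20 : t2 != 0) (two0 : 2%:R != 0 :> F).
Hypotheses (ad_even : a1 * a2 != d1 * d2) (ad_odd : a1 * d2 != a2 * d1).

Variable W : {vspace 'cV[F]_(2 * 2)}.
Hypothesis W_stable : forall g v, v \in W -> rep g *m v \in W.

(** Rescaled by the inverse of [t1 * t2], tau fixes E and negates O; the half-sum and
    half-difference with the original vector are its two components. *)
Lemma tensor_even_odd x y z w : vec4 x y z w \in W ->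
  vec4 x 0 0 w \in W /\ vec4 0 y z 0 \in W.
Proof.
move=> vW; have := W_stable (cl Tau) vW; rewrite tensor_tau.
move=> /(memvZ (t1 * t2)^-1); rewrite scalerA mulVf ?mulf_neq0 // scale1r => uW.
split.
  have -> : vec4 x 0 0 w = 2^-1 *: (vec4 x y z w + vec4 x (- y) (- z) w).
    by rewrite vec4D vec4Z; congr vec4; field.
  by rewrite memvZ ?memvD.
have -> : vec4 0 y z 0 = 2^-1 *: (vec4 x y z w - vec4 x (- y) (- z) w).
  by rewrite -scaleN1r vec4Z vec4D vec4Z; congr vec4; field.
by rewrite memvZ ?memvB.
Qed.

(** The sign of [Sigma 0] is 1, so it acts as P + Q, and the grading of [W] separates the two
    images. *)
Lemma tensor_even x w : vec4 x 0 0 w \in W ->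
  vec4 (a1 * a2 * x + w) 0 0 (c1 * c2 * x + d1 * d2 * w) \in W /\
  vec4 0 (a1 * c2 * x + d2 * w) (c1 * a2 * x + d1 * w) 0 \in W.
Proof.
move=> vW; have := W_stable (cl (Sigma 0)) vW; rewrite tensor_sigma expr0.
by rewrite !mul1r !mulr0 !addr0 !add0r; exact: tensor_even_odd.
Qed.

Lemma tensor_odd y z : vec4 0 y z 0 \in W ->
  vec4 (a1 * y + a2 * z) 0 0 (c1 * d2 * y + d1 * c2 * z) \in W.
Proof.
move=> vW; have := W_stable (cl (Sigma 0)) vW; rewrite tensor_sigma expr0.
by rewrite !mul1r !mulr0 !addr0 !add0r => /tensor_even_odd[].
Qed.

Lemma odd_part_det_neq0 : a1 * c2 * d1 - d2 * c1 * a2 != 0.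
Proof.
rewrite odd_part_det mulf_neq0 ?subr_eq0 //.
by rewrite eq_sym [d1 * a2]mulrC.
Qed.

Lemma mem_vec4_even x w x' w' :
  vec4 x 0 0 w \in W -> vec4 x' 0 0 w' \in W -> x * w' - w * x' != 0 ->
  forall y z, vec4 y 0 0 z \in W.
Proof.
have E p q : vec4 p 0 0 q = p *: vec4 1 0 0 0 + q *: vec4 0 0 0 1 :> 'cV[F]__.
  by rewrite !vec4Z vec4D; congr vec4; ring.
rewrite [vec4 x _ _ _]E [vec4 x' _ _ _]E => vW uW D0 y z.
have [e1W e2W] := memv_det vW uW D0.
by rewrite E memvD ?memvZ.
Qed.

Lemma mem_vec4_odd x w x' w' :
  vec4 0 x w 0 \in W -> vec4 0 x' w' 0 \in W -> x * w' - w * x' != 0 ->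
  forall y z, vec4 0 y z 0 \in W.
Proof.
have E p q : vec4 0 p q 0 = p *: vec4 0 1 0 0 + q *: vec4 0 0 1 0 :> 'cV[F]__.
  by rewrite !vec4Z vec4D; congr vec4; ring.
rewrite [vec4 _ x _ _]E [vec4 _ x' _ _]E => vW uW D0 y z.
have [e1W e2W] := memv_det vW uW D0.
by rewrite E memvD ?memvZ.
Qed.

(* Modulo the first equation the second becomes
   2 (a1 a2 - d1 d2) (a1 - d1) (a2 - d2) x w = 0. *)
Lemma no_common_eigenvector x w
    (p := a1 * a2 * x + w) (q := c1 * c2 * x + d1 * d2 * w)
    (y := a1 * c2 * x + d2 * w) (z := c1 * a2 * x + d1 * w) :
    x * q - w * p = 0 ->
    x * (c1 * d2 * y + d1 * c2 * z) - w * (a1 * y + a2 * z) = 0 ->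
  x = 0 /\ w = 0.
Proof.
move=> eq1 eq2.
have /eqP : 2%:R * (a1 * a2 - d1 * d2) * (a1 - d1) * (a2 - d2) * (x * w) = 0.
  have -> : 2%:R * (a1 * a2 - d1 * d2) * (a1 - d1) * (a2 - d2) * (x * w) =
     (a1 * d2 + a2 * d1) * (x * q - w * p)
     - (x * (c1 * d2 * y + d1 * c2 * z) - w * (a1 * y + a2 * z)).
    by rewrite /p /q /y /z c1E c2E; ring.
  by rewrite eq1 eq2 mulr0 subr0.
rewrite !mulf_eq0 (negPf two0) !subr_eq0 (negPf ad_even) (negPf ad1) (negPf ad2) /=.
case/orP=> /eqP x0; move/eqP: eq1; rewrite /p /q x0.
  by rewrite !(mul0r, mulr0, add0r, sub0r) oppr_eq0 mulf_eq0 orbb => /eqP.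
rewrite !(mul0r, mulr0, addr0, subr0) !mulf_eq0 (negPf c10) (negPf c20) /=.
by rewrite orbb => /eqP.
Qed.

Lemma tensor_stable_full x w :
  vec4 x 0 0 w \in W -> (x != 0) || (w != 0) -> W = fullv.
Proof.
move=> vW xw0; have [pW qW] := tensor_even vW; have oW := tensor_odd qW.
have evenW y z : vec4 y 0 0 z \in W.
  (* If the vector v and P v are independent, they span E. Otherwise v is an eigenvector of P, hence
     not of Q^2, and v with Q^2 v spans E. *)
  have [D1|D1] := eqVneq (x * (c1 * c2 * x + d1 * d2 * w)
                          - w * (a1 * a2 * x + w)) 0; last first.
    exact: mem_vec4_even vW pW D1 y z.
  apply: (mem_vec4_even vW oW); apply: contraTneq xw0 => D2.
  by have [-> ->] := no_common_eigenvector D1 D2; rewrite eqxx.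
(* The images of e00 and e11 under Q are the columns of its matrix, independent by
   [odd_part_det_neq0], so they span O. *)
have [_ o1] := tensor_even (evenW 1 0); have [_ o2] := tensor_even (evenW 0 1).
rewrite !(mulr1, mulr0, addr0, add0r) in o1 o2.
have oddW y z : vec4 0 y z 0 \in W.
  apply: (mem_vec4_odd o1 o2); apply: contra_neq odd_part_det_neq0 => <-.
  by ring.
apply/vspaceP => v; rewrite memvf; have [x' [y [z [w' ->]]]] := vec4_eta v.
have -> : vec4 x' y z w' = vec4 x' 0 0 w' + vec4 0 y z 0 :> 'cV[F]__.
  by rewrite vec4D !addr0 !add0r.
by rewrite memvD.
Qed.

Lemma tensor_stable_trivial : W = 0%VS \/ W = fullv.
Proof.
have [->|W0] := eqVneq W 0%VS; [by left|right].
have := vpick0 W; rewrite (negPf W0); have := memv_pick W.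
have [x [y [z [w ->]]]] := vec4_eta (vpick W).
move=> /tensor_even_odd[eW oW]; rewrite vec4_eq0 => nz.
have [/andP[x0 w0]|xw] := boolP ((x == 0) && (w == 0)); last first.
  by apply: tensor_stable_full eW _; rewrite -negb_and.
(* The chosen vector now lies in O; Q carries it into E, and injectivity of Q keeps it nonzero. *)
apply: tensor_stable_full (tensor_odd oW) _.
rewrite -negb_and; apply: contraFN nz => /andP[/eqP e1 /eqP e2].
rewrite x0 w0 andbT /=; apply/andP.
have D z' : (a1 * c2 * d1 - d2 * c1 * a2) * z' = 0 -> z' == 0.
  by move/eqP; rewrite mulf_eq0 (negPf odd_part_det_neq0).
split; apply: D.
(* The coefficients here and in the next case are the rows of the adjugate of Q from O to E. *)
- have -> : (a1 * c2 * d1 - d2 * c1 * a2) * y = d1 * c2 * (a1 * y + a2 * z)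
     - a2 * (c1 * d2 * y + d1 * c2 * z) by ring.
  by rewrite e1 e2 !mulr0 subr0.
- have -> : (a1 * c2 * d1 - d2 * c1 * a2) * z = a1 * (c1 * d2 * y + d1 * c2 * z)
     - c1 * d2 * (a1 * y + a2 * z) by ring.
  by rewrite e1 e2 !mulr0 subr0.
Qed.

End Irreducible.

End TensorNB4.

(** * The criterion over the complex numbers *)

Lemma unity_root_neq0 (F : fieldType) n (t : F) :
  (0 < n)%N -> n.-unity_root t -> t != 0.
Proof.
move=> n0 /unity_rootP; apply: contra_eq_neq => ->.
by rewrite expr0n gtn_eqF // eq_sym oner_eq0.
Qed.

Unset Implicit Arguments.

Theorem theorem3p4 (R : realType) (t1 a1 c1 d1 t2 a2 c2 d2 : R[i])
  (t1_unity : 8.-unity_root t1) (t2_unity : 8.-unity_root t2)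
  (c1E : c1 = a1 ^+ 2 - a1 * d1 + d1 ^+ 2)
  (c2E : c2 = a2 ^+ 2 - a2 * d2 + d2 ^+ 2)
  (c1_neq0 : c1 != 0) (c2_neq0 : c2 != 0)
  (a1_neq_d1 : a1 != d1) (a2_neq_d2 : a2 != d2)
  (ad_neq0 : a1 * a2 * d1 * d2 != 0) :
  let rho1 := rho 4 (-1) t1 a1 c1 d1
    (nb4_satisfies t1_unity c1E a1_neq_d1) in
  let rho2 := rho 4 (-1) t2 a2 c2 d2
    (nb4_satisfies t2_unity c2E a2_neq_d2) in
  irreducible_rep (tensor_rep rho1 rho2) <->
  (a1 * a2 != d1 * d2 /\ a1 * d2 != a2 * d1).
Proof.
move: ad_neq0; rewrite !mulf_eq0 !negb_or -!andbA => /and4P[a10 a20 d10 d20].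
split=> [irr|[ad_even ad_odd]].
  split; apply/eqP => ad; move: irr.
    exact: tensor_reducible_even.
  exact: tensor_reducible_odd.
split=> // W; apply: tensor_stable_trivial => //.
- exact: unity_root_neq0 t1_unity.
- exact: unity_root_neq0 t2_unity.
- by rewrite Num.Theory.pnatr_eq0.
Qed.
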